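(* Let $K\subset\mathbb{R}^2$ be a convex body containing the origin in its interior, and let $u\in S^1$. Then $$\sqrt{V_K(\{u\})}+\sqrt{V_K(\{-u\})}\le\sqrt{V(K)},$$ with equality if and only if $K$ is a trapezoid with two sides parallel to the line $u^\bot$, and $u^\bot$ contains the intersection point of the diagonals of $K$.
   Context: A convex body in $\mathbb{R}^2$ is a compact convex set with non-empty interior; $V(\cdot)$ is area; $S^1$ is the unit circle; $u^\bot=\{x\in\mathbb{R}^2:\langle x,u\rangle=0\}$ is the line through the origin orthogonal to $u$. A trapezoid is a convex quadrilateral with at least one pair of parallel sides (parallelograms are included). For a convex body $K\subset\mathbb{R}^2$ with the origin in its interior, the cone volume measure $V_K$ is the Borel measure on $S^1$ given by $V_K(\omega)=\int_\omega\frac{h_K(u)}{2}\,dS_K(u)$, where $h_K(u)=\max_{x\in K}\langle x,u\rangle$ is the support function and $S_K$ is the surface area measure of $K$. In particular, $V_K(\{u\})=\frac12 h_K(u)\cdot\mathrm{length}(F(K,u))$, where $F(K,u)=\{x\in K:\langle x,u\rangle=h_K(u)\}$; this is the area of the convex hull of the origin and $F(K,u)$. *)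

(* Defs.v *)
From HB Require Import structures.
From mathcomp Require Import all_boot all_order all_algebra.
From mathcomp Require Import all_classical all_reals all_analysis.
Set Implicit Arguments.
Unset Strict Implicit.
Unset Printing Implicit Defensive.
Import Order.TTheory GRing.Theory Num.Theory.
Import numFieldNormedType.Exports.
Local Open Scope classical_set_scope.
Local Open Scope ring_scope.

(* R^2.  The library norm of a product type is the max norm; it induces the
   usual topology, but Euclidean lengths have to go through [enorm]. *)
Notation plane R := (R^o * R^o)%type.

Definition dot (R : realType) (x y : plane R) : R := x.1 * y.1 + x.2 * y.2.

Definition cross (R : realType) (x y : plane R) : R := x.1 * y.2 - x.2 * y.1.

Definition enorm (R : realType) (x : plane R) : R := Num.sqrt (dot x x).

Definition circle (R : realType) : set (plane R) := [set u | enorm u = 1].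

Definition perp (R : realType) (u : plane R) : set (plane R) :=
  [set x | dot x u = 0].

Definition convex (R : realType) (K : set (plane R)) : Prop :=
  @convex_set R (plane R) K.

Definition convex_hull (R : realType) (A : set (plane R)) : set (plane R) :=
  smallest (@convex R) A.

Definition segment (R : realType) (a b : plane R) : set (plane R) :=
  [set (1 - t) *: a + t *: b | t in `[0, 1]].

Definition convex_body (R : realType) (K : set (plane R)) : Prop :=
  [/\ compact K, convex K & K° !=set0].

Definition area (R : realType) (K : set (plane R)) : \bar R :=
  (lebesgue_measure \x lebesgue_measure)%E K.

(* Euclidean diameter; the maximum with 0 makes the diameter of the empty set
   0 instead of -oo. *)
Definition diam (R : realType) (A : set (plane R)) : \bar R :=
  (maxe 0 (ereal_sup [set (enorm (x - y)%R)%:E | x in A & y in A]))%E.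

Definition hausdorff1_pre (R : realType) (delta : R) (A : set (plane R)) :
    \bar R :=
  ereal_inf [set (\sum_(0 <= k <oo) diam (F k))%E
            | F in [set F : (set (plane R))^nat
                   | A `<=` \bigcup_k F k /\
                     forall k, (diam (F k) <= delta%:E)%E]].

(* One-dimensional Hausdorff (outer) measure, i.e. length. *)
Definition hausdorff1 (R : realType) (A : set (plane R)) : \bar R :=
  ereal_sup [set hausdorff1_pre delta A | delta in [set delta : R | 0 < delta]].

Definition support_function (R : realType) (K : set (plane R)) (u : plane R) :
    R :=
  sup [set dot x u | x in K].

Definition face (R : realType) (K : set (plane R)) (u : plane R) :
    set (plane R) :=
  [set x | K x /\ dot x u = support_function K u].

(* S_K(w) is the length of the set of boundary points of K having an outer unit
   normal in w.  Measures on S^1 are written as set functions on the plane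
   that are concentrated on S^1. *)
Definition surface_area_measure (R : realType) (K : set (plane R))
    (w : set (plane R)) : \bar R :=
  hausdorff1 (\bigcup_(v in w `&` @circle R) face K v).

(* The library integral is defined for any set function and evaluates it only
   on Borel sets, where surface_area_measure K is a measure. *)
Definition cone_volume_measure (R : realType) (K : set (plane R))
    (w : set (plane R)) : \bar R :=
  (\int[surface_area_measure K]_(v in w) (support_function K v / 2)%:E)%E.

(* The vertices a, b, c, d are listed counterclockwise, so the sides are
   [a,b], [b,c], [c,d], [d,a] and the diagonals are [a,c], [b,d]; four left
   turns make the quadrilateral convex and non-degenerate. *)
Definition convex_quadrilateral (R : realType) (K : set (plane R))
    (a b c d : plane R) : Prop :=
  [/\ 0 < cross (b - a) (c - b), 0 < cross (c - b) (d - c),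
      0 < cross (d - c) (a - d) & 0 < cross (a - d) (b - a)] /\
  K = convex_hull [set a; b; c; d].

(* Vertices labelled so that the sides [a,b] and [c,d] are parallel. *)
Definition trapezoid (R : realType) (K : set (plane R)) (a b c d : plane R) :
    Prop :=
  convex_quadrilateral K a b c d /\ cross (b - a) (d - c) = 0.

(* Main.v *)
Require Import Defs.
From HB Require Import structures.
From mathcomp Require Import all_boot all_order all_algebra.
From mathcomp Require Import all_classical all_reals all_analysis.
From mathcomp Require Import measurable_realfun.
From mathcomp Require Import ring lra.
Set Implicit Arguments.
Unset Strict Implicit.
Unset Printing Implicit Defensive.
Import Order.TTheory GRing.Theory Num.Theory.
Import numFieldNormedType.Exports.
Local Open Scope classical_set_scope.
Local Open Scope ring_scope.

(** Let h1, h2 be the values of the support function of K at u and - u, and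
    let m1, m2 be the lengths of the faces F(K, u) and F(K, - u), which are
    parallel segments.  The two cone volumes are h1 m1 / 2 and h2 m2 / 2.  By
    convexity K contains the convex hull T of the two faces, a trapezoid
    (possibly degenerate) with parallel sides m1, m2 and height h1 + h2, hence
    of area (h1 + h2) (m1 + m2) / 2.  The inequality is then Cauchy-Schwarz,
      sqrt (h1 m1) + sqrt (h2 m2) <= sqrt ((h1 + h2) (m1 + m2)),
    with equality exactly when h1 m2 = h2 m1 ([sqrt_sum_le]).

    In the equality case K and T have the same finite area.  A point of K
    outside the closed set T would bring along a whole ball of K outside T,
    because it is a limit of interior points of K; therefore K = T
    ([area_eq_sub]).  Moreover h1 m2 = h2 m1 says that m1 and m2 vanish
    together; both cannot vanish since T has positive area, so T is a genuine
    trapezoid.  Its diagonals meet at the point that divides them in the ratio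
    m1 : m2 = h1 : h2 counted from the side of normal u, that is, at height 0.
    Conversely, for a trapezoid T the faces in the directions u and - u are the
    parallel sides, and the position of the intersection point of the diagonals
    gives back h1 m2 = h2 m1.

    Three measure-theoretic facts connect this argument to the definitions: the
    integral over a singleton with respect to a set function
    ([integral_singleton]), the fact that the Hausdorff measure of a segment is
    its length ([hausdorff1_segment]), and the area of a tilted trapezoid
    ([area_trap]).  The last one is reduced to the region between two graphs by
    a rotation, which preserves area since it is a product of shears
    ([area_linmap]). *)

(** * Integrals over a singleton *)

Section SingletonIntegral.
Import HBNNSimple.

Lemma sintegral_supp1 d (T : measurableType d) (R : realType)
    (mu : set T -> \bar R) (t : T) (h : T -> R) :
  mu set0 = 0%E -> (forall x, x != t -> h x = 0) ->
  sintegral mu h = ((h t)%:E * mu [set t])%E.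
Proof.
move=> mu0 h0; rewrite /sintegral -(@fsbig_widen _ _ _ _ [set h t]) //=.
  rewrite fsbig_set1; have [->|ht0] := eqVneq (h t) 0; first by rewrite !mul0e.
  congr (_ * mu _)%E; apply/seteqP; split => x /=; last by move->.
  have [//|xt] := eqVneq x t; rewrite h0 // => /esym/eqP.
  by rewrite (negbTE ht0).
move=> r /= [_ rt]; have [->|r0] := eqVneq r 0; first by rewrite mul0e.
suff -> : h @^-1` [set r] = set0 by rewrite mu0 mule0.
apply/seteqP; split => // x /= hx; have [xt|xt] := eqVneq x t.
  by apply: rt; rewrite -hx xt.
by move: hx; rewrite h0 // => /esym/eqP; rewrite (negbTE r0).
Qed.

(** A nonnegative simple function [h] below [g] vanishes off [t] as well, so its
    integral is [h t] times [mu [set t]], and [h t] can be as large as [c]. *)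
Lemma sup_sintegral_supp1 d (T : measurableType d) (R : realType)
    (mu : set T -> \bar R) (t : T) (g : T -> \bar R) (c : R) :
  measurable [set t] -> mu set0 = 0%E -> (0 <= mu [set t])%E ->
  0 <= c -> g t = c%:E -> (forall x, x != t -> g x = 0%E) ->
  ereal_sup [set sintegral mu h | h in
    [set h : {nnsfun T >-> R} | forall x, ((h x)%:E <= g x)%E]]
  = (c%:E * mu [set t])%E.
Proof.
move=> mt mu0 mut c0 gt g0.
apply/eqP; rewrite eq_le; apply/andP; split.
  apply: ge_ereal_sup => _ [h /= hg <-].
  rewrite (sintegral_supp1 (t := t)) //; last first.
    move=> x xt; apply/eqP; rewrite eq_le fun_ge0 andbT.
    by have := hg x; rewrite g0.
  by apply: lee_wpmul2r => //; rewrite -gt; exact: hg.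
apply: ereal_sup_ubound; exists (scale_nnsfun (indic_nnsfun R mt) c0).
  move=> x /=; rewrite mindicE; have [->|xt] := eqVneq x t.
    by rewrite gt mem_set //= mulr1.
  by rewrite g0 // memNset /= ?mulr0 //; apply/eqP.
rewrite (sintegral_supp1 (t := t)) //=.
  by rewrite mindicE mem_set //= mulr1.
by move=> x xt; rewrite mindicE memNset /= ?mulr0 //; apply/eqP.
Qed.

Lemma integral_singleton d (T : measurableType d) (R : realType)
    (mu : set T -> \bar R) (t : T) (f : T -> R) :
  measurable [set t] -> mu set0 = 0%E -> (0 <= mu [set t])%E -> 0 <= f t ->
  (\int[mu]_(x in [set t]) (f x)%:E = (f t)%:E * mu [set t])%E.
Proof.
move=> mt mu0 mut ft; rewrite /integral.
rewrite (sup_sintegral_supp1 (t := t) (c := f t)) //; first last.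
- by move=> x xt; rewrite funeposE patchE memNset ?maxxx //=; apply/eqP.
- by rewrite funeposE patchE mem_set // -EFin_max max_l.
rewrite (sup_sintegral_supp1 (t := t) (c := 0)) //; first last.
- by move=> x xt; rewrite funenegE patchE memNset ?oppe0 ?maxxx //=; apply/eqP.
- by rewrite funenegE patchE mem_set //= -EFin_max max_r // oppr_le0.
by rewrite mul0e sube0.
Qed.

End SingletonIntegral.

(** * Length of a segment *)

Lemma scale_planeE (R : realType) (a : R) (x : plane R) :
  a *: x = (a * x.1, a * x.2) :> plane R.
Proof. by []. Qed.

Lemma enorm_ge0 (R : realType) (x : plane R) : 0 <= enorm x.
Proof. exact: sqrtr_ge0. Qed.

Lemma enormZ (R : realType) (a : R) (x : plane R) :
  enorm (a *: x) = `|a| * enorm x.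
Proof.
rewrite /enorm -sqrtr_sqr -sqrtrM ?sqr_ge0 //; congr Num.sqrt.
rewrite scale_planeE /dot /=; ring.
Qed.

Lemma diam_ge0 (R : realType) (A : set (plane R)) : (0 <= diam A)%E.
Proof. by rewrite /diam le_max lexx. Qed.

Lemma enorm_le_diam (R : realType) (A : set (plane R)) (x y : plane R) :
  A x -> A y -> ((enorm (x - y))%:E <= diam A)%E.
Proof.
move=> Ax Ay; rewrite /diam le_max; apply/orP; right.
by apply: ereal_sup_ubound; exists x => //; exists y.
Qed.

Lemma diam_le (R : realType) (A : set (plane R)) (d : R) : 0 <= d ->
  (forall x y, A x -> A y -> enorm (x - y) <= d) -> (diam A <= d%:E)%E.
Proof.
move=> d0 Ad; rewrite /diam ge_max lee_fin d0 /=.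
by apply: ge_ereal_sup => _ [x Ax [y Ay <-]]; rewrite lee_fin; exact: Ad.
Qed.

Lemma diam_set0 (R : realType) : diam (@set0 (plane R)) = 0%E.
Proof. by apply/eqP; rewrite eq_le diam_ge0 andbT; exact: diam_le. Qed.

Lemma hausdorff1_pre_ge0 (R : realType) (delta : R) (A : set (plane R)) :
  (0 <= hausdorff1_pre delta A)%E.
Proof.
apply: le_ereal_inf_tmp => _ [F _ <-]; apply: nneseries_ge0 => n _ _.
exact: diam_ge0.
Qed.

Lemma hausdorff1_ge0 (R : realType) (A : set (plane R)) : (0 <= hausdorff1 A)%E.
Proof.
apply: (le_trans (hausdorff1_pre_ge0 1 A)).
by apply: ereal_sup_ubound; exists 1 => /=.
Qed.

Lemma hausdorff1_set0 (R : realType) : hausdorff1 (@set0 (plane R)) = 0%E.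
Proof.
apply/eqP; rewrite eq_le hausdorff1_ge0 andbT.
apply: ge_ereal_sup => _ [delta /= delta0 <-].
apply: ereal_inf_lbound; exists (fun=> set0); last first.
  by apply: eseries0 => i _ _; exact: diam_set0.
by split=> [x //|k]; rewrite diam_set0 lee_fin ltW.
Qed.

Lemma enorm_segment (R : realType) (p q : plane R) (s t : R) :
  enorm (((1 - s) *: p + s *: q) - ((1 - t) *: p + t *: q)) =
  `|s - t| * enorm (q - p).
Proof.
rewrite -enormZ; congr enorm.
by rewrite !scale_planeE; congr (_, _); rewrite /=; ring.
Qed.

(** Cutting the segment into [n] equal pieces, with [n] so large that the pieces
    have diameter at most [delta], gives a covering of total diameter equal to
    the length. *)
Lemma hausdorff1_segment_le (R : realType) (p q : plane R) :
  (hausdorff1 (segment p q) <= (enorm (q - p))%:E)%E.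
Proof.
set L := enorm (q - p); have L0 : 0 <= L := enorm_ge0 _.
apply: ge_ereal_sup => _ [delta /= delta0 <-].
pose n := (Num.trunc (L / delta)).+1.
have n0 : 0 < n%:R :> R by rewrite ltr0n.
have Ln : L / n%:R <= delta.
  rewrite ler_pdivrMr // mulrC -ler_pdivrMr //; apply/ltW; exact: truncnS_gt.
pose F k := if (k < n)%N then
  [set (1 - t) *: p + t *: q | t in `[k%:R / n%:R, k.+1%:R / n%:R]] else set0.
have dF k : (diam (F k) <= (L / n%:R)%:E)%E.
  rewrite /F; case: ifP => _; last by rewrite diam_set0 lee_fin divr_ge0 // ltW.
  apply: diam_le; first by rewrite divr_ge0 // ltW.
  move=> _ _ [s sI <-] [t tI <-]; rewrite enorm_segment mulrC ler_wpM2l //.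
  move: sI tI; rewrite /= !in_itv /= => /andP[s1 s2] /andP[t1 t2].
  have kn : k.+1%:R / n%:R = k%:R / n%:R + n%:R^-1 :> R.
    by rewrite -natr1 mulrDl mul1r.
  rewrite kn in s2 t2; rewrite ler_norml; lra.
apply: (@le_trans _ _ (\sum_(0 <= k <oo) diam (F k))%E).
  apply: ereal_inf_lbound; exists F => //; split; last first.
    by move=> k; apply: le_trans (dF k) _; rewrite lee_fin.
  move=> _ [t tI <-]; move: tI; rewrite /= in_itv /= => /andP[t0 t1].
  (* The pieces are indexed by the integer part of t * n, which is n itself at
     t = 1; that endpoint belongs to the last piece. *)
  have [t_lt1|t_ge1] := ltP t 1; last first.
    have n1 : (n.-1 < n)%N by [].
    exists n.-1 => //; rewrite /F n1; exists t => //=.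
    by rewrite in_itv /= divff ?gt_eqF // t1 (le_trans _ t_ge1) // ler_pdivrMr //
      mul1r ler_nat leqnSn.
  have tn0 : 0 <= t * n%:R by rewrite mulr_ge0 // ltW.
  have /andP[t2 t3] := truncn_itv tn0.
  exists (Num.trunc (t * n%:R)) => //; rewrite /F ifT; last first.
    by rewrite -(ltr_nat R) (le_lt_trans t2) // -[ltRHS]mul1r ltr_pM2r.
  by exists t => //=; rewrite in_itv /= ler_pdivrMr // ler_pdivlMr // t2 ltW.
rewrite (nneseries_split 0 n) => [|k _]; last exact: diam_ge0.
rewrite add0n eseries0 ?adde0; last first.
  by move=> i ni _; rewrite /F ltnNge ni /= diam_set0.
apply: (@le_trans _ _ (\sum_(0 <= k < n) (L / n%:R)%:E)%E).
  by apply: lee_sum => k _; exact: dF.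
by rewrite sumEFin sumr_const_nat subn0 lee_fin -[leLHS]mulr_natr divfK ?gt_eqF.
Qed.

(** A covering of the segment by sets [F k] pulls back to a covering of [[0, 1]]
    by parameter sets; the one of [F k] lies in an interval of length
    [diam (F k) / L].  Countable subadditivity of the Lebesgue measure then
    bounds the total diameter from below. *)
Lemma hausdorff1_segment_ge (R : realType) (p q : plane R) :
  ((enorm (q - p))%:E <= hausdorff1 (segment p q))%E.
Proof.
set L := enorm (q - p); have : 0 <= L := enorm_ge0 _.
rewrite le_eqVlt => /predU1P[<-|L0]; first exact: hausdorff1_ge0.
apply: (@le_trans _ _ (hausdorff1_pre 1 (segment p q))); last first.
  by apply: ereal_sup_ubound; exists 1 => /=.
apply: le_ereal_inf_tmp => _ [F [cF dF] <-].
pose d k := fine (diam (F k)).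
have dE k : diam (F k) = (d k)%:E.
  rewrite /d fineK // ge0_fin_numE ?diam_ge0 //.
  exact: le_lt_trans (dF k) (ltry 1).
pose T k : set R :=
  [set t | 0 <= t <= 1 /\ F k ((1 - t) *: p + t *: q)].
pose I k := `[sup (T k) - d k / L, sup (T k)]%R.
have TI k t : T k t -> t \in I k.
  move=> Tt; have ubT : ubound (T k) 1 by move=> s [/andP[]].
  have hT : has_sup (T k) by split; [exists t|exists 1].
  rewrite in_itv /= (sup_upper_bound hT) // andbT lerBlDr.
  apply: ge_sup; first by exists t.
  move=> s Ts; rewrite -lerBlDl ler_pdivlMr //.
  apply: (@le_trans _ _ (`|s - t| * L)); first by rewrite ler_pM2r // ler_norm.
  rewrite -enorm_segment -lee_fin -dE.
  by apply: enorm_le_diam; [case: Ts|case: Tt].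
have cov : `[0, 1]%classic `<=` \bigcup_k [set` I k].
  move=> t /=; rewrite in_itv /= => t01.
  have /cF[k _ Fk] : segment p q ((1 - t) *: p + t *: q).
    by exists t => //=; rewrite in_itv.
  by exists k => //=; apply: TI.
have : (lebesgue_measure (`[0%R, 1%R]%classic : set R) <=
    \sum_(0 <= k <oo) lebesgue_measure ([set` I k] : set R))%E.
  by apply: measure_sigma_subadditive => // k; exact: measurable_itv.
rewrite lebesgue_measure_itv /= lte_fin ltr01 oppr0 adde0.
have -> : (\sum_(0 <= k <oo) lebesgue_measure ([set` I k] : set R) =
    \sum_(0 <= k <oo) (L^-1)%:E * diam (F k))%E.
  apply: eq_eseriesr => k _; rewrite lebesgue_measure_itv /= lte_fin dE.
  case: ifPn => [_|]; first by rewrite -EFinB -EFinM; congr EFin; ring.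
  have : 0 <= d k by rewrite -lee_fin -dE diam_ge0.
  rewrite le_eqVlt => /predU1P[<-|dk0]; first by rewrite mule0.
  by rewrite gtrBl divr_gt0.
rewrite nneseriesZl => [|k _]; last exact: diam_ge0.
by rewrite lee_pdivlMl ?mule1.
Qed.

Lemma hausdorff1_segment (R : realType) (p q : plane R) :
  hausdorff1 (segment p q) = (enorm (q - p))%:E.
Proof.
by apply/eqP; rewrite eq_le hausdorff1_segment_le hausdorff1_segment_ge.
Qed.

(** * Area: measurability and linear invariance *)

(** The type [plane R], presented as the product of Borel lines on which the
    product of the Lebesgue measures is declared. *)
Notation mplane R := (measurableTypeR R * measurableTypeR R)%type.

(** An open set is the union of the boxes with rational vertices that it
    contains, and there are countably many of them. *)
Lemma open_plane_measurable (R : realType) (U : set (plane R)) :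
  open U -> measurable (U : set (mplane R)).
Proof.
move=> oU.
pose box (p q : rat * rat) : set (mplane R) :=
  `]ratr p.1, ratr p.2[%classic `*` `]ratr q.1, ratr q.2[%classic.
pose F p q : set (mplane R) := [set x | box p q x /\ box p q `<=` U].
have -> : U = \bigcup_p \bigcup_q F p q.
  apply/seteqP; split=> [x Ux|x [p _ [q _ [bx bU]]]]; last exact: bU.
  have /nbhs_ballP[e /= e0 xeU] : nbhs x U by exact: open_nbhs_nbhs.
  have itv (z : R) : exists p : rat * rat,
      z \in `]ratr p.1, ratr p.2[%R /\
      forall y : R, y \in `]ratr p.1, ratr p.2[%R -> `|z - y| < e.
    have [a] := rat_in_itvoo (ltac:(by rewrite ltrBlDr ltrDl) : z - e < z).
    have [b] := rat_in_itvoo (ltac:(by rewrite ltrDl) : z < z + e).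
    rewrite !in_itv /= => /andP[zb be] /andP[ea az]; exists (a, b).
    rewrite in_itv /= az zb; split=> // y; rewrite in_itv /= => /andP[ay yb].
    by rewrite ltr_norml; apply/andP; split; lra.
  have [p [xp pe]] := itv x.1; have [q [xq qe]] := itv x.2.
  exists p => //; exists q => //; split; first by split.
  by move=> y [/pe y1 /qe y2]; apply: xeU; split.
apply: countable_bigcupT_measurable => [|p]; first exact: countableP.
apply: countable_bigcupT_measurable => [|q]; first exact: countableP.
rewrite /F; have [bU|bU] := pselect (box p q `<=` U).
  rewrite (_ : [set _ | _] = box p q).
    by apply: measurableX; exact: measurable_itv.
  by apply/seteqP; split=> [x []|].
by rewrite (_ : [set _ | _] = set0) //; apply/seteqP; split=> [x []|].
Qed.

Lemma closed_plane_measurable (R : realType) (A : set (plane R)) :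
  closed A -> measurable (A : set (mplane R)).
Proof.
by move=> /closed_openC/open_plane_measurable/measurableC; rewrite setCK.
Qed.

Lemma lebesgue_measure_shift (R : realType) (c : R) (A : set R) :
  measurable A ->
  lebesgue_measure ((fun y => y + c) @^-1` A) = lebesgue_measure A.
Proof.
move=> mA.
have mf : measurable_fun setT
    (fun y : measurableTypeR R => y + c : measurableTypeR R).
  exact: measurable_funD.
transitivity (pushforward (@lebesgue_measure R)
  (fun y : measurableTypeR R => y + c : measurableTypeR R) A) => //.
apply/esym/lebesgue_measure_unique => //= _ [[a b]] _ <-.
rewrite /pushforward.
rewrite (_ : _ @^-1` _ = `]a - c, b - c]%classic); last first.
  by apply/seteqP; split=> y /=; rewrite !in_itv /= ltrBlDr lerBrDr.
rewrite !lebesgue_measure_itv /= !lte_fin ltrD2r.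
by case: ifP => // _; rewrite -!EFinB; congr EFin; ring.
Qed.

Definition linmap (R : realType) (a b c d : R) (x : mplane R) : mplane R :=
  (a * x.1 + b * x.2, c * x.1 + d * x.2).

Lemma measurable_linmap (R : realType) (a b c d : R) :
  measurable_fun setT (linmap a b c d).
Proof.
by apply: measurable_fun_pair; apply: measurable_funD; apply: measurable_funM.
Qed.

Lemma measurable_linmap_preimage (R : realType) (a b c d : R)
    (A : set (mplane R)) : measurable A -> measurable (linmap a b c d @^-1` A).
Proof.
by move=> mA; rewrite -[X in measurable X]setTI; exact: measurable_linmap.
Qed.

(** A shear along the second axis translates every vertical section. *)
Lemma area_shear2 (R : realType) (c : R) (A : set (mplane R)) :
  measurable A -> area (linmap 1 0 c 1 @^-1` A) = area A.
Proof.
move=> mA; rewrite /area /product_measure1; apply: eq_integral => x _ /=.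
rewrite (_ : xsection _ x = (fun y => y + c * x) @^-1` xsection A x); last first.
  apply/seteqP; split=> y; rewrite /= !xsectionE /linmap /= !mul1r mul0r addr0;
  by rewrite addrC.
by rewrite lebesgue_measure_shift //; exact: measurable_xsection.
Qed.

(** Tonelli: the area can also be computed by horizontal sections, which a shear
    along the first axis translates. *)
Lemma area_ysection (R : realType) (A : set (mplane R)) : measurable A ->
  area A = (\int[lebesgue_measure]_y lebesgue_measure (ysection A y))%E.
Proof.
move=> mA; transitivity
  (product_measure2 (@lebesgue_measure R) (@lebesgue_measure R) A) => //.
by apply: product_measure_unique => // B C mB mC /=; rewrite product_measure2E.
Qed.

Lemma area_shear1 (R : realType) (c : R) (A : set (mplane R)) :
  measurable A -> area (linmap 1 c 0 1 @^-1` A) = area A.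
Proof.
move=> mA; rewrite !area_ysection //; last exact: measurable_linmap_preimage.
apply: eq_integral => y _ /=.
rewrite (_ : ysection _ y = (fun x => x + c * y) @^-1` ysection A y); last first.
  by apply/seteqP; split=> x; rewrite /= !ysectionE /linmap /= !mul1r mul0r add0r.
by rewrite lebesgue_measure_shift //; exact: measurable_ysection.
Qed.

(** A matrix of determinant 1 with a nonzero lower left entry [c] is a product of
    three shears, with coefficients [(a - 1) / c], [c] and [(d - 1) / c].  When
    [c] is zero, one more shear makes it nonzero. *)
Lemma area_linmap (R : realType) (a b c d : R) (A : set (mplane R)) :
  a * d - b * c = 1 -> measurable A -> area (linmap a b c d @^-1` A) = area A.
Proof.
have shear3 (a' b' c' d' : R) (B : set (mplane R)) : c' != 0 ->
    a' * d' - b' * c' = 1 -> measurable B ->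
    area (linmap a' b' c' d' @^-1` B) = area B.
  move=> c0 det mB; pose s := (a' - 1) / c'; pose t := (d' - 1) / c'.
  have b'E : b' = (a' * d' - 1) / c' by rewrite -det; field.
  rewrite (_ : _ @^-1` _ = linmap 1 t 0 1 @^-1` (linmap 1 0 c' 1 @^-1`
      (linmap 1 s 0 1 @^-1` B))).
    by rewrite area_shear1 ?area_shear2 ?area_shear1 //;
      do ?apply: measurable_linmap_preimage.
  apply/seteqP; split=> x /=; congr (B _); rewrite /linmap /= b'E /s /t;
    by congr (_, _); field.
move=> det mA; have [c0|c0] := eqVneq c 0; last exact: shear3.
rewrite (_ : _ @^-1` _ = linmap a b a (b + d) @^-1` (linmap 1 0 (-1) 1 @^-1` A)).
  rewrite shear3 ?area_shear2 //; last exact: measurable_linmap_preimage.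
    by apply: contra_eq_neq det => ->; rewrite c0 mul0r mulr0 subr0 eq_sym oner_eq0.
  by rewrite -det c0; ring.
apply/seteqP; split=> x /=; congr (A _); rewrite /linmap /= c0; congr (_, _); ring.
Qed.

(** * Area between two graphs *)

Lemma area_ge0 (R : realType) (A : set (plane R)) : (0 <= area A)%E.
Proof. exact: measure_ge0. Qed.

Lemma le_area (R : realType) (A B : set (mplane R)) :
  measurable A -> measurable B -> A `<=` B -> (area A <= area B)%E.
Proof. by move=> mA mB AB; apply: le_measure; rewrite ?inE. Qed.

Lemma integral_deriv_poly (R : realType) (P : {poly R}) (a b : R) : a < b ->
  (\int[lebesgue_measure]_(x in `[a, b]) (P^`().[x])%:E = (P.[b] - P.[a])%:E)%E.
Proof.
move=> ab; rewrite (@continuous_FTC2 _ _ (horner P)) //.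
- by apply: continuous_subspaceT => x; exact: continuous_horner.
- split; first by move=> x _; exact: derivable_horner.
  + by apply: cvg_at_right_filter; exact: continuous_horner.
  + by apply: cvg_at_left_filter; exact: continuous_horner.
- by move=> x _; rewrite derivE.
Qed.

(** The vertical section at [t] is the interval from [f.[t]] to [g.[t]], and [P]
    is a primitive of its length. *)
Lemma area_between (R : realType) (f g P : {poly R}) (a b : R) : a < b ->
  (forall t, a <= t <= b -> f.[t] <= g.[t]) -> P^`() = g - f ->
  area [set x | a <= x.1 <= b /\ f.[x.1] <= x.2 <= g.[x.1]] =
  (P.[b] - P.[a])%:E.
Proof.
move=> ab fg Pfg; rewrite -integral_deriv_poly // /area /product_measure1.
rewrite [RHS]integral_mkcond; apply: eq_integral => x _ /=.
rewrite patchE mem_setE in_itv /=; case: ifPn => [xab|xab]; last first.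
  rewrite (_ : xsection _ _ = set0) ?measure0 //.
  by apply/seteqP; split=> y //=; rewrite xsectionE /= (negbTE xab) => -[].
rewrite (_ : xsection _ _ = `[f.[x], g.[x]]%classic); last first.
  by apply/seteqP; split=> y; rewrite xsectionE /= xab in_itv /=; [case|].
rewrite lebesgue_measure_itv /= lte_fin Pfg hornerD hornerN.
by case: ltgtP (fg _ xab) => [||->] // _; rewrite subrr.
Qed.

(** * Orthonormal frames *)

Lemma dot_comb (R : realType) (a b : R) (x y v : plane R) :
  dot (a *: x + b *: y) v = a * dot x v + b * dot y v.
Proof. by rewrite /dot !scale_planeE /=; ring. Qed.

Lemma dotBl (R : realType) (x y v : plane R) :
  dot (x - y) v = dot x v - dot y v.
Proof. by rewrite /dot /=; ring. Qed.

Lemma dotNr (R : realType) (x v : plane R) : dot x (- v) = - dot x v.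
Proof. by rewrite /dot /=; ring. Qed.

Lemma circleP (R : realType) (u : plane R) : circle u <-> dot u u = 1.
Proof.
rewrite /circle /= /enorm; split=> [|->]; last exact: sqrtr1.
have d0 : 0 <= dot u u by rewrite /dot addr_ge0 // -expr2 sqr_ge0.
by move=> d1; rewrite -(sqr_sqrtr d0) d1 expr1n.
Qed.

Lemma dotNN (R : realType) (u : plane R) : dot (- u) (- u) = dot u u.
Proof. by rewrite /dot /=; ring. Qed.

Definition rot90 (R : realType) (u : plane R) : plane R := (- u.2, u.1).

Lemma rot90N (R : realType) (u : plane R) : rot90 (- u) = - rot90 u.
Proof. by []. Qed.

(** The point of height [t] in the direction [u] and abscissa [s] along the line
    orthogonal to [u], the latter oriented so that the basis is positive. *)
Definition frame (R : realType) (u : plane R) (t s : R) : plane R :=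
  t *: u + s *: rot90 u.

Lemma frameN (R : realType) (u : plane R) (t s : R) :
  frame (- u) t s = frame u (- t) (- s).
Proof. by rewrite /frame rot90N !scalerN !scaleNr. Qed.

Section Frame.
Variables (R : realType) (u : plane R).
Hypothesis u1 : dot u u = 1.

Lemma frame_dot t s : dot (frame u t s) u = t.
Proof.
by rewrite dot_comb u1 mulr1 /dot /=; ring.
Qed.

Lemma frame_dot90 t s : dot (frame u t s) (rot90 u) = s.
Proof.
rewrite dot_comb [X in _ + s * X](_ : _ = dot u u); last by rewrite /dot /=; ring.
by rewrite u1 /dot /=; ring.
Qed.

Lemma frameE x : x = frame u (dot x u) (dot x (rot90 u)).
Proof.
have u1' : u.2 * u.2 = 1 - u.1 * u.1 by rewrite -u1 /dot; ring.
case: x => x1 x2; rewrite /frame !scale_planeE /dot; congr (_, _) => /=; ring: u1'.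
Qed.

Lemma frame_inj x y :
  dot x u = dot y u -> dot x (rot90 u) = dot y (rot90 u) -> x = y.
Proof. by move=> e1 e2; rewrite (frameE x) (frameE y) e1 e2. Qed.

Lemma crossE x y : cross x y =
  dot x u * dot y (rot90 u) - dot x (rot90 u) * dot y u.
Proof.
by rewrite -[LHS]mul1r -u1 /dot /cross /=; ring.
Qed.

Lemma enorm_frameB t s s' : s <= s' -> enorm (frame u t s' - frame u t s) = s' - s.
Proof.
move=> ss'; rewrite /enorm (_ : dot _ _ = (s' - s) ^+ 2).
  by rewrite sqrtr_sqr ger0_norm // subr_ge0.
by rewrite -[RHS]mulr1 -u1 /frame !scale_planeE /dot /=; ring.
Qed.

Lemma segment_between p q x : dot p u = dot x u -> dot q u = dot x u ->
  dot p (rot90 u) <= dot x (rot90 u) <= dot q (rot90 u) -> segment p q x.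
Proof.
move=> pu qu /andP[px xq].
have [pq|pq] := eqVneq (dot p (rot90 u)) (dot q (rot90 u)).
  exists 0; first by rewrite /= in_itv /= lexx ler01.
  apply: frame_inj; rewrite dot_comb; first by rewrite pu; ring.
  by apply/eqP; rewrite subr0 mul1r mul0r addr0 eq_le px pq.
have d0 : 0 < dot q (rot90 u) - dot p (rot90 u).
  by rewrite subr_gt0 lt_neqAle pq (le_trans px).
exists ((dot x (rot90 u) - dot p (rot90 u)) / (dot q (rot90 u) - dot p (rot90 u))).
  rewrite /= in_itv /= divr_ge0 ?(ltW d0) ?subr_ge0 //=.
  by rewrite ler_pdivrMr // mul1r lerD2r.
apply: frame_inj; rewrite dot_comb; first by rewrite pu qu; ring.
by field; rewrite gt_eqF.
Qed.

End Frame.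

Lemma convexP (R : realType) (K : set (plane R)) :
  convex K <-> forall x y, K x -> K y -> segment x y `<=` K.
Proof.
split=> [cK x y Kx Ky _ [t + <-]|cK x y l].
  rewrite /= in_itv /= => /andP[t0 t1].
  have s0 : 0 <= 1 - t by rewrite subr_ge0.
  have s1 : 1 - t <= 1 by rewrite gerBl.
  have := cK x y (Itv01 s0 s1); rewrite !inE => /(_ Kx Ky).
  by rewrite /conv /= /unstable.onem subKr.
rewrite !inE => Kx Ky; apply: (cK x y) => //; exists (unstable.onem l%:num) => /=.
  by rewrite in_itv /= unstable.onem_ge0 // unstable.onem_le1.
by rewrite {1}/unstable.onem subKr.
Qed.

(** * Support function, faces and cone volumes *)

Lemma continuous_dot (R : realType) (v : plane R) :
  continuous (fun x : plane R => dot x v : R).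
Proof.
move=> x; apply: cvgD; apply: cvgM; try exact: cvg_cst.
  exact: cvg_fst.
exact: cvg_snd.
Qed.

Lemma closed_halfplane (R : realType) (v : plane R) (c : R) :
  closed [set x : plane R | c <= dot x v].
Proof.
apply: (@closed_comp _ _ (fun x : plane R => dot x v : R) [set y | c <= y]).
  by move=> x _; exact: continuous_dot.
exact: closed_ge.
Qed.

Lemma support_functionE (R : realType) (K : set (plane R)) (u c : plane R) :
  K c -> (forall x, K x -> dot x u <= dot c u) -> support_function K u = dot c u.
Proof.
move=> Kc cmax; apply/eqP; rewrite eq_le; apply/andP; split.
  by apply: ge_sup => [|_ [x Kx <-]]; [exists (dot c u), c|exact: cmax].
apply: sup_upper_bound; last by exists c.
by split; [exists (dot c u), c|exists (dot c u) => _ [x Kx <-]; exact: cmax].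
Qed.

Lemma plane_measurable_set1 (R : realType) (u : plane R) :
  measurable ([set u] : set (R * R)%type).
Proof.
rewrite (_ : [set u] = [set u.1] `*` [set u.2]).
  by apply: measurableX; exact: measurable_set1.
apply/seteqP; split=> [_ -> //|[x1 x2] /= [-> ->]]; exact/esym/surjective_pairing.
Qed.

(** The only points of [K] with an outer normal in [[set u]] are those of the
    face, so the surface area measure of that singleton is the face's length. *)
Lemma cone_volume_measure_face (R : realType) (K : set (plane R))
    (u p q : plane R) : circle u -> 0 <= support_function K u ->
  face K u = segment p q ->
  cone_volume_measure K [set u] =
  (support_function K u / 2 * enorm (q - p))%:E.
Proof.
move=> u1 h0 Kpq.
have SK : surface_area_measure K [set u] = (enorm (q - p))%:E.
  rewrite -hausdorff1_segment -Kpq /surface_area_measure; congr hausdorff1.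
  by apply/seteqP; split=> [x [v [-> _]] //|x Kx]; exists u.
rewrite /cone_volume_measure integral_singleton ?SK //.
- exact: plane_measurable_set1.
- rewrite /surface_area_measure -[RHS](hausdorff1_set0 R); congr hausdorff1.
  by apply/seteqP; split=> [x [v []]|].
- by rewrite lee_fin enorm_ge0.
- by rewrite divr_ge0.
Qed.

(** * Trapezoids orthogonal to a direction *)

(** The convex hull of the points [frame u t1 l1], [frame u t1 r1],
    [frame u t2 l2] and [frame u t2 r2], described by the inequalities of its
    sides.  Those of the slanted sides are multiplied by [t2 - t1], so that no
    division occurs; a side of length zero, which makes the region a triangle,
    is allowed. *)
Definition trap (R : realType) (u : plane R) (t1 t2 l1 r1 l2 r2 : R) :
    set (plane R) :=
  [set x | t1 <= dot x u <= t2 /\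
    (t2 - dot x u) * l1 + (dot x u - t1) * l2 <= (t2 - t1) * dot x (rot90 u) <=
    (t2 - dot x u) * r1 + (dot x u - t1) * r2].

(** Reversing [u] exchanges the two parallel sides, so whatever is proved for the
    side of normal [u] also holds for the other one. *)
Lemma trapN (R : realType) (u : plane R) (t1 t2 l1 r1 l2 r2 : R) :
  trap (- u) (- t2) (- t1) (- r2) (- l2) (- r1) (- l1) =
  trap u t1 t2 l1 r1 l2 r2.
Proof.
apply/seteqP; split=> x; rewrite /trap /= rot90N !dotNr !lerN2 => -[/andP[h1 h2]];
  move=> /andP[h3 h4]; split; apply/andP; split=> //; lra.
Qed.

Lemma closed_trap (R : realType) (u : plane R) (t1 t2 l1 r1 l2 r2 : R) :
  closed (trap u t1 t2 l1 r1 l2 r2).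
Proof.
pose H := t2 - t1.
have -> : trap u t1 t2 l1 r1 l2 r2 =
    ([set x | t1 <= dot x u] `&` [set x | - t2 <= dot x (- u)]) `&`
    ([set x | t2 * l1 - t1 * l2 <= dot x (H *: rot90 u + (l1 - l2) *: u)] `&`
     [set x | t1 * r2 - t2 * r1 <= dot x ((- H) *: rot90 u + (r2 - r1) *: u)]).
  have dE a b x : dot x (a *: rot90 u + b *: u) =
      a * dot x (rot90 u) + b * dot x u.
    by rewrite /dot !scale_planeE /=; ring.
  apply/seteqP; split=> x; rewrite /trap /= !dE dotNr /H.
    by move=> [/andP[? ?] /andP[? ?]]; split; split; lra.
  by move=> [[? ?] [? ?]]; split; apply/andP; split; lra.
by apply: closedI; apply: closedI; exact: closed_halfplane.
Qed.

Lemma convex_trap (R : realType) (u : plane R) (t1 t2 l1 r1 l2 r2 : R) :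
  convex (trap u t1 t2 l1 r1 l2 r2).
Proof.
apply/convexP => x y [/andP[x1 x2] /andP[x3 x4]] [/andP[y1 y2] /andP[y3 y4]].
move=> _ [t + <-]; rewrite /= in_itv /= => /andP[t0 t1'].
have s0 : 0 <= 1 - t by rewrite subr_ge0.
by rewrite /trap /= !dot_comb; split; apply/andP; split; nra.
Qed.

Section Trapezoid.
Variables (R : realType) (u : plane R) (t1 t2 l1 r1 l2 r2 : R).
Hypotheses (u1 : dot u u = 1) (t12 : t1 < t2) (lr1 : l1 <= r1) (lr2 : l2 <= r2).
Let H0 : 0 < t2 - t1. Proof. by rewrite subr_gt0. Qed.

Lemma trap_frame t s : trap u t1 t2 l1 r1 l2 r2 (frame u t s) <->
  t1 <= t <= t2 /\ (t2 - t) * l1 + (t - t1) * l2 <= (t2 - t1) * s <=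
    (t2 - t) * r1 + (t - t1) * r2.
Proof. by rewrite /trap /= frame_dot ?frame_dot90. Qed.

Lemma trap_vertices : [/\ trap u t1 t2 l1 r1 l2 r2 (frame u t1 l1),
  trap u t1 t2 l1 r1 l2 r2 (frame u t1 r1),
  trap u t1 t2 l1 r1 l2 r2 (frame u t2 l2) &
  trap u t1 t2 l1 r1 l2 r2 (frame u t2 r2)].
Proof.
have t12' := ltW t12.
by split; apply/trap_frame; rewrite lexx ?t12'; split=> //;
  rewrite !subrr !mul0r ?add0r ?addr0 !ler_pM2l // ?lexx ?lr1 ?lr2.
Qed.

(** The horizontal line through a point of the region meets the two slanted sides
    in points that divide them in the same ratio [m]; the point lies between
    those two. *)
Lemma trap_sub_convex (K : set (plane R)) : convex K ->
  K (frame u t1 l1) -> K (frame u t1 r1) ->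
  K (frame u t2 l2) -> K (frame u t2 r2) ->
  trap u t1 t2 l1 r1 l2 r2 `<=` K.
Proof.
move=> /convexP cK Kl1 Kr1 Kl2 Kr2 x [/andP[x1 x2] /andP[x3 x4]].
pose m := (dot x u - t1) / (t2 - t1).
have mH : m * (t2 - t1) = dot x u - t1 by rewrite divfK ?gt_eqF.
have m01 : m \in `[0, 1]%R.
  rewrite in_itv /= divr_ge0 ?(ltW H0) ?subr_ge0 //=.
  by rewrite ler_pdivrMr // mul1r lerD2r.
have L := cK _ _ Kl1 Kl2 _ (ex_intro2 _ _ m m01 erefl).
have M := cK _ _ Kr1 Kr2 _ (ex_intro2 _ _ m m01 erefl).
apply: (cK _ _ L M); apply: (segment_between u1).
- by rewrite dot_comb !frame_dot //; lra.
- by rewrite dot_comb !frame_dot //; lra.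
rewrite dot_comb (dot_comb _ _ (frame u t1 r1)) !frame_dot90 //.
rewrite -(ler_pM2l H0) -[X in _ && X](ler_pM2l H0).
have e a b : (t2 - t1) * ((1 - m) * a + m * b) =
    (t2 - dot x u) * a + (dot x u - t1) * b.
  by rewrite -mH; transitivity ((t2 - (dot x u - t1) - t1) * a + m * (t2 - t1) * b);
   [rewrite -mH|]; ring.
by rewrite !e x3.
Qed.

Lemma support_trap : support_function (trap u t1 t2 l1 r1 l2 r2) u = t2.
Proof.
have [_ _ c _] := trap_vertices.
by rewrite (support_functionE c) ?frame_dot // => x [/andP[]].
Qed.

Lemma face_trap : face (trap u t1 t2 l1 r1 l2 r2) u =
  segment (frame u t2 l2) (frame u t2 r2).
Proof.
rewrite /face support_trap; apply/seteqP; split=> x /=.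
  move=> [[_]] + xu; rewrite xu subrr !mul0r !add0r !ler_pM2l // => xlr.
  by apply: (segment_between u1); rewrite ?frame_dot // !frame_dot90.
move=> xs; have [_ _ c d] := trap_vertices.
have /convexP cT := @convex_trap R u t1 t2 l1 r1 l2 r2.
split; first exact: cT xs.
by case: xs => m _ <-; rewrite dot_comb !frame_dot //; ring.
Qed.

(** The rotation that takes [u] to the first basis vector reduces the claim to
    the region between the graphs of two affine functions. *)
Lemma area_trap : area (trap u t1 t2 l1 r1 l2 r2) =
  ((t2 - t1) * ((r1 - l1) + (r2 - l2)) / 2)%:E.
Proof.
pose e1 : plane R := (1, 0).
pose T : set (mplane R) := trap e1 t1 t2 l1 r1 l2 r2.
have mT : measurable T by apply: closed_plane_measurable; exact: closed_trap.
have det : u.1 * u.1 - u.2 * - u.2 = 1 by rewrite mulrN opprK -u1.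
transitivity (area T).
  rewrite -(area_linmap det mT); congr area.
  apply/seteqP; split=> x; rewrite /T /trap /linmap /dot /= !(mul1r, mul0r, mulr1,
    mulr0, oppr0, addr0, add0r, mulrN, mulNr) ![_ * u.1]mulrC ![_ * u.2]mulrC //.
(* g a b is the affine function with value a at t1 and b at t2, and
   c0 + 2 * c1 * 'X is g r1 r2 - g l1 l2. *)
pose g (a b : R) : {poly R} := ((t2 * a - t1 * b) / (t2 - t1))%:P +
  ((b - a) / (t2 - t1))%:P * 'X.
have gE a b t : (t2 - t1) * (g a b).[t] = (t2 - t) * a + (t - t1) * b.
  by rewrite /g !hornerE /=; field; rewrite gt_eqF.
pose c0 := (t2 * (r1 - l1) - t1 * (r2 - l2)) / (t2 - t1).
pose c1 := ((r2 - l2) - (r1 - l1)) / (t2 - t1) / 2.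
rewrite (_ : T = [set x | t1 <= x.1 <= t2 /\
    (g l1 l2).[x.1] <= x.2 <= (g r1 r2).[x.1]]); last first.
  have e x : dot x e1 = x.1 by rewrite /dot /= mulr1 mulr0 addr0.
  have e' x : dot x (rot90 e1) = x.2.
    by rewrite /dot /= oppr0 mulr0 mulr1 add0r.
  by apply/seteqP; split=> x; rewrite /T /trap /= e e' -!gE !ler_pM2l.
rewrite (@area_between _ _ _ (c0%:P * 'X + c1%:P * 'X^2)) //.
- congr EFin; rewrite !hornerE /c0 /c1 /=; field; rewrite gt_eqF //.
- move=> t /andP[ta tb]; rewrite -(ler_pM2l H0) !gE.
  by apply: lerD; rewrite ler_wpM2l ?subr_ge0.
- rewrite !(derivD, derivM, derivC, derivX, derivXn) /g.
  rewrite !mul0r !add0r mulr1 expr1 -mulr_natl.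
  rewrite opprD addrACA -mulrBl -!polyCB mulrA -polyC_natr -polyCM.
  congr (_%:P + _%:P * _); rewrite /c0 /c1; field; rewrite gt_eqF //.
Qed.

End Trapezoid.

(** * Convex bodies and area *)

Lemma ball_planeE (R : realType) (y : plane R) (r : R) :
  ball y r = (ball (y.1 : R) r `*` ball (y.2 : R) r) :> set (plane R).
Proof. by []. Qed.

Lemma area_setX (R : realType) (A B : set R) : measurable A -> measurable B ->
  area (A `*` B) = (lebesgue_measure A * lebesgue_measure B)%E.
Proof.
by move=> mA mB;
  have := @product_measure1E _ _ (measurableTypeR R) (measurableTypeR R) R
    lebesgue_measure lebesgue_measure A B mA mB.
Qed.

Lemma measurable_ball_plane (R : realType) (y : plane R) (r : R) :
  measurable (ball y r : set (mplane R)).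
Proof.
rewrite ball_planeE !ball_itv.
by apply: measurableX; exact: measurable_itv.
Qed.

Lemma area_ball_gt0 (R : realType) (y : plane R) (r : R) :
  0 < r -> (0 < area (ball y r))%E.
Proof.
move=> r0; rewrite ball_planeE area_setX; last 2 first.
- by rewrite ball_itv; exact: measurable_itv.
- by rewrite ball_itv; exact: measurable_itv.
rewrite !ball_itv !lebesgue_measure_itv /= !lte_fin.
have e (z : R) : z - r < z + r by lra.
by rewrite !e mule_gt0 // -EFinB lte_fin subr_gt0.
Qed.

Lemma area_interior_gt0 (R : realType) (K : set (plane R)) :
  closed K -> K° !=set0 -> (0 < area K)%E.
Proof.
move=> cK [x /nbhs_ballP[r /= r0 xrK]].
apply: lt_le_trans (area_ball_gt0 x r0) _.
apply: le_area => //; first exact: measurable_ball_plane.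
exact: closed_plane_measurable.
Qed.

(** The homothety of centre [x] and small ratio [m] maps a ball around the origin
    contained in [K] to a ball around [(1 - m) *: x], contained in [K] by
    convexity and close to [x]. *)
Lemma convex_ball_near (R : realType) (K : set (plane R)) (x : plane R) (e : R) :
  convex K -> K° 0 -> K x -> 0 < e ->
  exists y r, 0 < r /\ ball y r `<=` K `&` ball x e.
Proof.
move=> /convexP cK /nbhs_ballP[d /= d0 dK] Kx e0.
pose M := `|x.1| + `|x.2| + 1.
have M0 : 0 < M by rewrite ltr_pwDr // addr_ge0.
pose m := Num.min (1/2) (e / 2 / M).
have m0 : 0 < m by rewrite lt_min !divr_gt0.
have m1 : m <= 1 by rewrite ge_min; apply/orP; left; lra.
have mM : m * M <= e / 2 by rewrite -ler_pdivlMr // ge_min lexx orbT.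
exists ((1 - m) *: x), (Num.min (m * d) (e / 2)); split.
  by rewrite lt_min mulr_gt0 ?divr_gt0.
move=> z; rewrite ball_planeE /= /ball /= !lt_min.
move=> [/andP[z1d z1e] /andP[z2d z2e]]; split.
  pose k := m^-1 *: (z - (1 - m) *: x).
  have Kk : K k.
    apply: dK; rewrite ball_planeE; split; rewrite /= /ball /= sub0r normrN.
      by rewrite normrM gtr0_norm ?invr_gt0 // mulrC ltr_pdivrMr // distrC mulrC.
    by rewrite normrM gtr0_norm ?invr_gt0 // mulrC ltr_pdivrMr // distrC mulrC.
  apply: (cK x k) => //; exists m; first by rewrite /= in_itv /= (ltW m0).
  by rewrite /k scalerA divff ?gt_eqF // scale1r addrC subrK.
have near (a b : R) : `|(1 - m) * a - b| < e / 2 -> `|a| <= M -> `|a - b| < e.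
  move=> ab aM; rewrite (_ : a - b = ((1 - m) * a - b) + m * a); last by ring.
  rewrite (le_lt_trans (ler_normD _ _)) // [ltRHS]splitr ltr_leD //.
  by rewrite normrM gtr0_norm // (le_trans _ mM) // ler_pM2l.
have := normr_ge0 x.1; have := normr_ge0 x.2 => x1 x2.
by split; apply: near => //; rewrite /M; lra.
Qed.

(** A point of [K] outside the closed set [T] yields a ball contained in [K] and
    disjoint from [T], which contributes a positive area. *)
Lemma area_eq_sub (R : realType) (K T : set (plane R)) :
  convex K -> closed K -> K° 0 -> closed T -> T `<=` K ->
  (area T < +oo)%E -> (area K <= area T)%E -> K = T.
Proof.
move=> cvK clK K0 clT TK Tfin KT; apply/seteqP; split=> // x Kx.
apply: contrapT => nTx.
have /nbhs_ballP[e /= e0 eT] : nbhs x (~` T).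
  by apply: open_nbhs_nbhs; split=> //; exact: closed_openC.
have [y [r [r0 yr]]] := convex_ball_near cvK K0 Kx e0.
have mT := closed_plane_measurable clT.
have mB := @measurable_ball_plane _ y r.
have : (area T + area (ball y r) <= area K)%E.
  rewrite -[leLHS](@measureU _ _ _ (lebesgue_measure \x lebesgue_measure)%E) //.
    apply: le_area; [exact: measurableU|exact: closed_plane_measurable|].
    by move=> z [/TK//|/yr[]].
  by apply/seteqP; split=> // z [Tz /yr[_ /eT]].
move=> /le_trans/(_ KT); apply/negP; rewrite -ltNge -[ltLHS]adde0 lteD2lE.
  exact: area_ball_gt0.
by rewrite ge0_fin_numE ?area_ge0.
Qed.

(** A face is compact and convex and lies on a line orthogonal to [u]; its
    endpoints are the extremal points in the direction [rot90 u]. *)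
Lemma face_segment (R : realType) (K : set (plane R)) (u : plane R) :
  compact K -> convex K -> K !=set0 -> dot u u = 1 ->
  exists l r, [/\ l <= r,
    face K u = segment (frame u (support_function K u) l)
                       (frame u (support_function K u) r),
    K (frame u (support_function K u) l),
    K (frame u (support_function K u) r) &
    forall x, K x -> dot x u <= support_function K u].
Proof.
move=> cK cvK K0 u1.
have cont v (A : set (plane R)) :
    {within A, continuous (fun x : plane R => dot x v : R)}.
  by apply: continuous_subspaceT; exact: continuous_dot.
have [c /set_mem Kc cmax] := compact_EVT_max K0 cK (cont u K).
have hE : support_function K u = dot c u.
  by apply: support_functionE => // x Kx; apply: cmax; exact: mem_set.
set h := support_function K u in hE *.
have hmax x : K x -> dot x u <= h by move=> Kx; rewrite hE cmax ?mem_set.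
have fE : face K u = K `&` [set x | h <= dot x u].
  apply/seteqP; split=> x [Kx] /=; first by rewrite -/h => ->.
  by move=> hx; split=> //; apply/eqP; rewrite eq_le hmax.
have cF : compact (face K u).
  by rewrite fE; apply: compact_closedI => //; exact: closed_halfplane.
have F0 : face K u !=set0 by exists c.
have [q /set_mem [Kq qu] qmax] := compact_EVT_max F0 cF (cont (rot90 u) _).
have [p /set_mem [Kp pu] pmin] := compact_EVT_min F0 cF (cont (rot90 u) _).
have pE : frame u h (dot p (rot90 u)) = p by rewrite [RHS](frameE u1) pu.
have qE : frame u h (dot q (rot90 u)) = q by rewrite [RHS](frameE u1) qu.
exists (dot p (rot90 u)), (dot q (rot90 u)); split; rewrite ?pE ?qE //.
  by apply: pmin; exact: mem_set.
apply/seteqP; split=> [x Fx|x pqx].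
  apply: (segment_between u1); rewrite ?pu ?qu ?Fx.2 //.
  by rewrite pmin ?qmax //; exact: mem_set.
split; first by move/convexP: cvK; apply; last exact: pqx.
by case: pqx => m _ <-; rewrite dot_comb pu qu; ring.
Qed.

Lemma support_function_gt0 (R : realType) (K : set (plane R)) (u : plane R) :
  K° 0 -> dot u u = 1 -> (forall x, K x -> dot x u <= support_function K u) ->
  0 < support_function K u.
Proof.
move=> /nbhs_ballP[d /= d0 dK] u1 hmax.
pose M := `|u.1| + `|u.2| + 1.
have a1 := normr_ge0 u.1; have a2 := normr_ge0 u.2.
have M0 : 0 < M by rewrite /M; lra.
pose m := d / M; have m0 : 0 < m by rewrite divr_gt0.
have mM : m * M = d by rewrite divfK ?gt_eqF.
have /hmax : K (m *: u).
  apply: dK; rewrite ball_planeE; split; rewrite /= /ball /= sub0r normrN;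
  by rewrite normrM (gtr0_norm m0) -mM ltr_pM2l // /M; lra.
apply: lt_le_trans; rewrite -[m *: u]addr0 -(scale0r u) dot_comb u1 mulr1 mul0r.
by rewrite addr0.
Qed.

(** With [p, q, P, Q] as in the proof, [p * q = P * Q], so the square of the right
    side exceeds that of the left side by [(P - Q) ^+ 2].  This is the
    Cauchy-Schwarz inequality, with its case of equality. *)
Lemma sqrt_sum_le (R : realType) (h1 h2 l1 l2 : R) :
  0 < h1 -> 0 < h2 -> 0 <= l1 -> 0 <= l2 ->
  Num.sqrt (h1 / 2 * l1) + Num.sqrt (h2 / 2 * l2) <=
    Num.sqrt ((h1 + h2) * (l1 + l2) / 2) ?= iff (h1 * l2 == h2 * l1).
Proof.
move=> h10 h20 l10 l20.
have n1 : 0 <= h1 / 2 by lra.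
have n2 : 0 <= h2 / 2 by lra.
pose p := Num.sqrt (h1 / 2 * l1); pose q := Num.sqrt (h2 / 2 * l2).
pose P := Num.sqrt (h1 / 2 * l2); pose Q := Num.sqrt (h2 / 2 * l1).
have p2 : p ^+ 2 = h1 / 2 * l1 by apply: sqr_sqrtr; exact: mulr_ge0.
have q2 : q ^+ 2 = h2 / 2 * l2 by apply: sqr_sqrtr; exact: mulr_ge0.
have P2 : P ^+ 2 = h1 / 2 * l2 by apply: sqr_sqrtr; exact: mulr_ge0.
have Q2 : Q ^+ 2 = h2 / 2 * l1 by apply: sqr_sqrtr; exact: mulr_ge0.
have pq : p * q = P * Q by rewrite /p /q /P /Q !(sqrtrM _ n1) !(sqrtrM _ n2); ring.
have p0 : 0 <= p := sqrtr_ge0 _. have q0 : 0 <= q := sqrtr_ge0 _.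
have P0 : 0 <= P := sqrtr_ge0 _. have Q0 : 0 <= Q := sqrtr_ge0 _.
have E : (h1 + h2) * (l1 + l2) / 2 = (p + q) ^+ 2 + (P - Q) ^+ 2.
  transitivity (p ^+ 2 + q ^+ 2 + P ^+ 2 + Q ^+ 2); last by ring: pq.
  by rewrite p2 q2 P2 Q2; ring.
have pqE : p + q = Num.sqrt ((p + q) ^+ 2) by rewrite sqrtr_sqr ger0_norm ?addr_ge0.
rewrite -/p -/q E {1}pqE; split.
  by rewrite ler_sqrt ?lerDl ?addr_ge0 ?sqr_ge0.
rewrite eqr_sqrt ?addr_ge0 ?sqr_ge0 // -subr_eq0 opprD addrA subrr sub0r.
rewrite oppr_eq0 sqrf_eq0 subr_eq0 -(eqrXn2 (n := 2)) // P2 Q2.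
by apply/eqP/eqP => e; lra.
Qed.

(** * Cone volumes of trapezoids *)

Section Hull.
Variables (R : realType) (u : plane R) (t1 t2 l1 r1 l2 r2 : R).
Hypotheses (u1 : dot u u = 1) (t12 : t1 < t2) (lr1 : l1 <= r1) (lr2 : l2 <= r2).
Local Notation T := (trap u t1 t2 l1 r1 l2 r2).

Lemma convex_hull_trap : convex_hull [set frame u t1 r1; frame u t1 l1;
  frame u t2 l2; frame u t2 r2] = T.
Proof.
have [v1 v2 v3 v4] := trap_vertices u1 t12 lr1 lr2.
apply/seteqP; split.
  apply: smallest_sub; first exact: convex_trap.
  by move=> x [[[]|]|] /= ->.
move=> x Tx L [cL Ls]; apply: (trap_sub_convex u1 t12 cL) Tx; apply: Ls.
- by left; left; right.
- by left; left; left.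
- by left; right.
- by right.
Qed.

Lemma cone_volume_trap : 0 <= t2 ->
  cone_volume_measure T [set u] = (t2 / 2 * (r2 - l2))%:E.
Proof.
move=> t20; rewrite (cone_volume_measure_face _ _ (face_trap u1 t12 lr1 lr2)).
- by rewrite support_trap // enorm_frameB.
- exact/circleP.
- by rewrite support_trap.
Qed.

End Hull.

Lemma cone_volume_trapN (R : realType) (u : plane R) (t1 t2 l1 r1 l2 r2 : R) :
  dot u u = 1 -> t1 < t2 -> l1 <= r1 -> l2 <= r2 -> t1 <= 0 ->
  cone_volume_measure (trap u t1 t2 l1 r1 l2 r2) [set - u] =
  (- t1 / 2 * (r1 - l1))%:E.
Proof.
move=> u1 t12 lr1 lr2 t10; rewrite -trapN cone_volume_trap ?dotNN ?ltrN2 ?lerN2 //.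
  by rewrite opprK addrC.
by rewrite oppr_ge0.
Qed.

(** * The inequality and its equality case *)

(** The trapezoid is the convex hull of the faces of normals [u] and [- u]. *)
Lemma spanned_trap (R : realType) (K : set (plane R)) (u : plane R) :
  convex_body K -> K° 0 -> dot u u = 1 ->
  exists h1 h2 l1 r1 l2 r2, [/\ 0 < h1, 0 < h2, l1 <= r1 & l2 <= r2] /\
  [/\ trap u (- h2) h1 l1 r1 l2 r2 `<=` K,
    cone_volume_measure K [set u] = (h1 / 2 * (r2 - l2))%:E &
    cone_volume_measure K [set - u] = (h2 / 2 * (r1 - l1))%:E].
Proof.
move=> [cK cvK _] K0 u1.
have Kn0 : K !=set0 by exists 0; exact: interior_subset.
have u1' : dot (- u) (- u) = 1 by rewrite dotNN.
have [l [r [lr fE Kl Kr hmax]]] := face_segment cK cvK Kn0 u1.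
have [l' [r' [lr' fE' Kl' Kr' hmax']]] := face_segment cK cvK Kn0 u1'.
have h0 := support_function_gt0 K0 u1 hmax.
have h0' := support_function_gt0 K0 u1' hmax'.
exists (support_function K u), (support_function K (- u)), (- r'), (- l'), l, r.
split; first by rewrite lerN2.
rewrite !frameN in Kl' Kr'; split.
- by apply: trap_sub_convex => //; rewrite (lt_trans _ h0) // oppr_lt0.
- rewrite (cone_volume_measure_face _ _ fE) ?(ltW h0) //; last exact/circleP.
  by rewrite enorm_frameB.
- rewrite (cone_volume_measure_face _ _ fE') ?(ltW h0') //; last exact/circleP.
  by rewrite enorm_frameB // opprK [- l' + _]addrC.
Qed.

(** The common point of the diagonals is found at the parameter
    [h2 / (h1 + h2)], which is where each diagonal has height 0; the relation
    between heights and side lengths makes the two abscissas agree there. *)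
Lemma trapezoid_trap (R : realType) (u : plane R) (h1 h2 l1 r1 l2 r2 : R) :
  dot u u = 1 -> 0 < h1 -> 0 < h2 -> l1 < r1 -> l2 < r2 ->
  h1 * (r1 - l1) = h2 * (r2 - l2) ->
  exists a b c d : plane R, [/\ trapezoid (trap u (- h2) h1 l1 r1 l2 r2) a b c d,
    perp u (b - a), perp u (d - c) &
    exists2 p : plane R, (segment a c `&` segment b d) p & perp u p].
Proof.
move=> u1 h10 h20 lr1 lr2 hl; have H0 : 0 < h1 + h2 by exact: addr_gt0.
have t12 : - h2 < h1 by rewrite -subr_gt0 opprK.
exists (frame u (- h2) r1), (frame u (- h2) l1), (frame u h1 l2), (frame u h1 r2).
split; [|by rewrite /perp /= dotBl !frame_dot // subrr..|].
  split; [split|]; last 1 first.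
  - rewrite (crossE u1) !dotBl !frame_dot // !frame_dot90 //.
    by rewrite !subrr mul0r mulr0 subrr.
  - rewrite !(crossE u1) !dotBl !frame_dot // !frame_dot90 // !subrr.
    by split; nra.
  - by rewrite convex_hull_trap ?ltW.
pose m := h2 / (h1 + h2).
have mH : m * (h1 + h2) = h2 by rewrite divfK ?gt_eqF.
have m01 : m \in `[0, 1]%R.
  by rewrite in_itv /= divr_ge0 ?(ltW h20) ?(ltW H0) //=
    ler_pdivrMr // mul1r lerDr ltW.
exists ((1 - m) *: frame u (- h2) r1 + m *: frame u h1 l2); first split.
- by exists m.
- exists m => //; apply: (frame_inj u1); rewrite !(dot_comb (1 - m)).
    by rewrite !frame_dot.
  rewrite !frame_dot90 //; apply: (mulfI (lt0r_neq0 H0)).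
  have e x y : (h1 + h2) * ((1 - m) * x + m * y) = h1 * x + h2 * y.
    transitivity ((h1 + h2 - m * (h1 + h2)) * x + m * (h1 + h2) * y); first ring.
    by rewrite mH; ring.
  by rewrite !e; lra.
- by rewrite /perp /= dot_comb !frame_dot //; lra.
Qed.

(** Both diagonals reach height 0 at the same parameter [m], since their
    endpoints have the same heights.  Equating the abscissas there gives
    [(1 - m) * (r1 - l1) = m * (r2 - l2)], which together with
    [(1 - m) * t1 + m * t2 = 0] is the case of equality in [sqrt_sum_le].  The hypothesis on [a] and [c] says that [u] points from the
    side [a b] to the side [c d]; the opposite case is that of [- u]. *)
Lemma sqrt_sum_trapezoid (R : realType) (K : set (plane R))
    (u a b c d p : plane R) :
  convex_body K -> K° 0 -> dot u u = 1 -> trapezoid K a b c d ->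
  perp u (b - a) -> perp u (d - c) ->
  (segment a c `&` segment b d) p -> perp u p -> dot a u < dot c u ->
  (sqrte (cone_volume_measure K [set u]) +
     sqrte (cone_volume_measure K [set (- u)%R]) = sqrte (area K))%E.
Proof.
move=> bK K0 u1 [[[cr1 _ cr3 _] KE] _] ba dc [[m _ mp] [n _ np]] pu ac.
rewrite /perp /= in ba dc pu.
move: cr1 cr3; rewrite !(crossE u1) ba dc !mul0r !sub0r !dotBl => cr1 cr3.
have bu : dot b u = dot a u by apply/eqP; rewrite -subr_eq0 -dotBl ba.
have du : dot d u = dot c u by apply/eqP; rewrite -subr_eq0 -dotBl dc.
set t1 := dot a u in ac bu cr1 cr3 *; set t2 := dot c u in ac du cr1 cr3 *.
set r1 := dot a (rot90 u) in cr1 cr3 *; set l1 := dot b (rot90 u) in cr1 cr3 *.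
set l2 := dot c (rot90 u) in cr1 cr3 *; set r2 := dot d (rot90 u) in cr1 cr3 *.
rewrite ?bu ?du in cr1 cr3.
have lr1 : l1 < r1 by nra.
have lr2 : l2 < r2 by nra.
have aE : a = frame u t1 r1 := frameE u1 a.
have bE : b = frame u t1 l1 by rewrite -bu; exact: frameE.
have cE : c = frame u t2 l2 := frameE u1 c.
have dE : d = frame u t2 r2 by rewrite -du; exact: frameE.
have KT : K = trap u t1 t2 l1 r1 l2 r2.
  by rewrite KE aE bE cE dE convex_hull_trap ?ltW.
have [cK cvK _] := bK.
have Kn0 : K !=set0 by exists 0; exact: interior_subset.
have t20 : 0 < t2.
  have [? [? [_ _ _ _ /(support_function_gt0 K0 u1)]]] :=
    face_segment cK cvK Kn0 u1.
  by rewrite {1}KT support_trap ?ltW.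
have u1' : dot (- u) (- u) = 1 by rewrite dotNN.
have t10 : 0 < - t1.
  have [? [? [_ _ _ _ /(support_function_gt0 K0 u1')]]] :=
    face_segment cK cvK Kn0 u1'.
  by rewrite {1}KT -trapN support_trap ?ltrN2 ?lerN2 ?ltW.
have mt : (1 - m) * t1 + m * t2 = 0 by rewrite -pu -mp dot_comb.
have nt : (1 - n) * t1 + n * t2 = 0 by rewrite -pu -np dot_comb bu du.
have mn : m = n.
  have t210 : t2 - t1 != 0 by rewrite gt_eqF // subr_gt0.
  by apply: (mulIf t210); lra.
have ms : (1 - m) * r1 + m * l2 = (1 - m) * l1 + m * r2.
  by rewrite -!dot_comb mp mn np.
have hl : t2 * (r1 - l1) = - t1 * (r2 - l2).
  apply: (mulfI (_ : t2 - t1 != 0)); first by rewrite gt_eqF // subr_gt0.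
  have mt' : m * (t2 - t1) = - t1 by lra.
  have ms' : (1 - m) * (r1 - l1) = m * (r2 - l2) by lra.
  have mt2 : (1 - m) * (t2 - t1) = t2 by lra.
  transitivity ((t2 - t1) * (t2 - t1) * ((1 - m) * (r1 - l1))).
    by transitivity ((t2 - t1) * ((1 - m) * (t2 - t1) * (r1 - l1)));
      [rewrite mt2|ring].
  by rewrite ms'; transitivity ((t2 - t1) * (m * (t2 - t1) * (r2 - l2)));
    [ring|rewrite mt'].
have t10' : t1 <= 0 by rewrite -oppr_ge0 ltW.
rewrite KT cone_volume_trap ?cone_volume_trapN ?area_trap // ?ltW //=.
rewrite -EFinD; congr EFin; apply/eqP.
have n1 : 0 <= r1 - l1 by rewrite subr_ge0 ltW.
have n2 : 0 <= r2 - l2 by rewrite subr_ge0 ltW.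
by rewrite [r1 - l1 + _]addrC (sqrt_sum_le t20 t10 n2 n1).2 hl.
Qed.

Theorem corollary1p2 (R : realType) (K : set (plane R)) (u : plane R)
    (hK : convex_body K) (h0 : K° 0) (hu : circle u) :
  (sqrte (cone_volume_measure K [set u]) +
     sqrte (cone_volume_measure K [set (- u)%R]) <= sqrte (area K))%E /\
  ((sqrte (cone_volume_measure K [set u]) +
      sqrte (cone_volume_measure K [set (- u)%R]) = sqrte (area K))%E <->
   exists a b c d : plane R,
     [/\ trapezoid K a b c d, perp u (b - a), perp u (d - c) &
         exists2 p : plane R, (segment a c `&` segment b d) p & perp u p]).
Proof.
have u1 := (circleP u).1 hu; have [cK cvK K0] := hK.
have clK : closed K by apply: compact_closed => //; exact: norm_hausdorff.
have [h1 [h2 [l1 [r1 [l2 [r2 [[h10 h20 lr1 lr2] [TK V1 V2]]]]]]]] :=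
  spanned_trap hK h0 u1.
set T := trap _ _ _ _ _ _ _ in TK.
have t12 : - h2 < h1 by rewrite (lt_trans _ h10) // oppr_lt0.
have aT : area T = ((h1 + h2) * ((r2 - l2) + (r1 - l1)) / 2)%:E.
  by rewrite area_trap // opprK [r1 - l1 + _]addrC.
have clT : closed T by exact: closed_trap.
have TKa : (area T <= area K)%E.
  by apply: le_area => //; exact: closed_plane_measurable.
have n1 : 0 <= r1 - l1 by rewrite subr_ge0.
have n2 : 0 <= r2 - l2 by rewrite subr_ge0.
have [sle seq] := sqrt_sum_le h10 h20 n2 n1.
have VT : (sqrte (cone_volume_measure K [set u]) +
    sqrte (cone_volume_measure K [set (- u)%R]) <= sqrte (area T))%E.
  by rewrite V1 V2 aT /= -EFinD lee_fin.
split; first by rewrite (le_trans VT) // lee_sqrt // area_ge0.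
split=> [Veq|[a [b [c [d [tr ba dc [p ps pu]]]]]]].
  have KTa : (area K <= area T)%E.
    by rewrite -lee_sqrt ?area_ge0 // -Veq.
  have KT : K = T.
    by apply: area_eq_sub => //; rewrite aT ltry.
  have : sqrte (area T) = sqrte (area K).
    by congr sqrte; apply/eqP; rewrite eq_le TKa KTa.
  rewrite -Veq V1 V2 aT /= -EFinD => -[/esym/eqP]; rewrite seq => /eqP hl.
  have areaT0 : (0 < area T)%E by rewrite -KT area_interior_gt0.
  rewrite KT; apply: trapezoid_trap => //.
  - rewrite -subr_gt0 lt_neqAle n1 andbT; apply/negP => /eqP e.
    have e' : r2 - l2 = 0.
      by apply: (mulfI (lt0r_neq0 h20)); rewrite -hl -e !mulr0.
    by move: areaT0; rewrite aT e' -e addr0 mulr0 mul0r ltxx.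
  - rewrite -subr_gt0 lt_neqAle n2 andbT; apply/negP => /eqP e.
    have e' : r1 - l1 = 0.
      by apply: (mulfI (lt0r_neq0 h10)); rewrite hl -e !mulr0.
    by move: areaT0; rewrite aT e' -e addr0 mulr0 mul0r ltxx.
have [ac|ca|ac] := ltgtP (dot a u) (dot c u).
- exact: (sqrt_sum_trapezoid hK h0 u1 tr ba dc ps pu ac).
- have perpN x : perp u x -> perp (- u) x.
    by rewrite /perp /= dotNr => ->; rewrite oppr0.
  have u1' : dot (- u) (- u) = 1 by rewrite dotNN.
  rewrite addeC -{2}[u]opprK.
  apply: (sqrt_sum_trapezoid hK h0 u1' tr (perpN _ ba) (perpN _ dc) ps (perpN _ pu)).
  by rewrite !dotNr ltrN2.
(* Sides at the same height would make the quadrilateral flat. *)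
- case: tr => -[[[+ _ _ _] _] _]; rewrite (crossE u1) ba mul0r sub0r !dotBl.
  have -> : dot b u = dot a u by apply/eqP; rewrite -subr_eq0 -dotBl ba.
  by rewrite ac subrr mulr0 oppr0 ltxx.
Qed.
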